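(* For every positive integer $b$ there is $a_0=a_0(b)$ such that for all integers $a\ge a_0$ the complete bipartite graph $K_{a,b}$ satisfies $\chi^\star_\ell (K_{a,b})= b+1$ and $\chi^\star_c (K_{a,b})=2b$.
   Context: Graphs are finite and simple. A list-assignment $L$ of a graph $G$ maps each vertex $v\in V(G)$ to a set $L(v)\subseteq\mathbb{N}$ of colours; it is a $k$-list-assignment if $|L(v)|=k$ for every $v$. A proper $L$-colouring is a map $c:V(G)\to\mathbb{N}$ with $c(v)\in L(v)$ for all $v$ and $c(u)\neq c(v)$ for every edge $uv$. A proper $L$-packing of $G$ of size $k$ is a collection of $k$ proper $L$-colourings $c_1,\dots,c_k$ that are mutually disjoint, i.e. $c_i(v)\neq c_j(v)$ for all $i\neq j$ and all $v\in V(G)$. The list packing number $\chi^\star_\ell(G)$ is the least $k$ such that $G$ admits a proper $L$-packing of size $k$ for every $k$-list-assignment $L$ of $G$. A $k$-fold correspondence-cover of $G$ via $L$ is a graph $H$ together with a mapping $L:V(G)\to 2^{V(H)}$ such that the sets $L(v)$, $v\in V(G)$, partition $V(H)$, $|L(v)|=k$ for every $v$, for every edge $vv'\in E(G)$ the edges of $H$ between $L(v)$ and $L(v')$ form a (possibly empty) matching, and for distinct nonadjacent $v,v'$ there is no edge of $H$ between $L(v)$ and $L(v')$. An independent transversal of $H$ with respect to $L$ (a correspondence $L$-colouring) is a set consisting of exactly one vertex from each $L(v)$ having no two members $x\in L(v)$, $y\in L(v')$ (with $v\neq v'$) adjacent in $H$. A ($k$-fold) correspondence $L$-packing of $H$ is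 a collection of $k$ mutually disjoint correspondence $L$-colourings. The correspondence packing number $\chi^\star_c(G)$ is the least $k$ such that every $k$-fold correspondence-cover $H$ of $G$ via any $L$ admits a $k$-fold correspondence $L$-packing. *)

(* Defs.v *)
From mathcomp Require Import all_boot finmap.

Set Implicit Arguments.
Unset Strict Implicit.
Unset Printing Implicit Defensive.

Record sgraph := SGraph {
  vertex :> finType;
  adj : rel vertex;
  adj_sym : symmetric adj;
  adj_irr : irreflexive adj
}.

Arguments adj {s} x y.

Definition bip_adj (a b : nat) : rel ('I_a + 'I_b)%type :=
  fun u v => match u, v with
             | inl _, inr _ | inr _, inl _ => true
             | _, _ => false
             end.

Lemma bip_adj_sym (a b : nat) : symmetric (@bip_adj a b).
Proof. by move=> [i|i] [j|j]. Qed.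

Lemma bip_adj_irr (a b : nat) : irreflexive (@bip_adj a b).
Proof. by case. Qed.

Definition complete_bipartite (a b : nat) : sgraph :=
  SGraph (@bip_adj_sym a b) (@bip_adj_irr a b).

Definition least_positive (P : nat -> Prop) (k : nat) : Prop :=
  [/\ 0 < k, P k & forall j, 0 < j -> P j -> k <= j].

Section ListPacking.

Variable G : sgraph.

Definition list_assignment := G -> {fset nat}.

Definition k_list_assignment (k : nat) (L : list_assignment) : Prop :=
  forall v, #|` L v|%fset = k.

Definition proper_list_colouring (L : list_assignment) (c : G -> nat) : Prop :=
  (forall v, c v \in L v) /\ (forall u v, adj u v -> c u <> c v).

Definition proper_list_packing (L : list_assignment) (k : nat)
    (c : 'I_k -> G -> nat) : Prop :=
  (forall i, proper_list_colouring L (c i)) /\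
  (forall i j, i != j -> forall v, c i v <> c j v).

Definition list_packable (k : nat) : Prop :=
  forall L : list_assignment, k_list_assignment k L ->
  exists c : 'I_k -> G -> nat, proper_list_packing L c.

(* Only positive sizes count: an empty packing exists for every 0-list-assignment. *)
Definition is_list_packing_number (k : nat) : Prop :=
  least_positive list_packable k.

End ListPacking.

(* For disjoint A and B, edges are encoded as pairs oriented from A to B. *)
Definition edges_between (H : sgraph) (A B : {set H}) : {set H * H} :=
  [set p | [&& p.1 \in A, p.2 \in B & adj p.1 p.2]].

Definition is_matching (H : sgraph) (M : {set H * H}) : Prop :=
  forall p q, p \in M -> q \in M -> p.1 = q.1 \/ p.2 = q.2 -> p = q.

Section CorrespondencePacking.

Variable G : sgraph.

(* The partition condition is stated for the indexed family L, so that distinct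
   vertices of G own disjoint parts. Edges of H inside a part are unrestricted. *)
Definition correspondence_cover (k : nat) (H : sgraph) (L : G -> {set H}) :
    Prop :=
  [/\ (forall v v', v != v' -> [disjoint L v & L v'])
        /\ \bigcup_v L v = [set: H],
      forall v, #|L v| = k,
      forall v v', adj v v' -> is_matching (edges_between (L v) (L v'))
    & forall v v', v != v' -> ~~ adj v v' ->
        edges_between (L v) (L v') = set0].

Definition independent_transversal (H : sgraph) (L : G -> {set H})
    (I : {set H}) : Prop :=
  (forall v, #|I :&: L v| = 1) /\
  (forall v v' x y, v != v' -> x \in I :&: L v -> y \in I :&: L v' ->
     ~~ adj x y).

Definition correspondence_packing (H : sgraph) (L : G -> {set H}) (k : nat)
    (I : 'I_k -> {set H}) : Prop :=
  (forall i, independent_transversal L (I i)) /\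
  (forall i j, i != j -> [disjoint I i & I j]).

Definition correspondence_packable (k : nat) : Prop :=
  forall (H : sgraph) (L : G -> {set H}), correspondence_cover k L ->
  exists I : 'I_k -> {set H}, correspondence_packing L I.

Definition is_correspondence_packing_number (k : nat) : Prop :=
  least_positive correspondence_packable k.

End CorrespondencePacking.

(* Main.v *)
Require Import Defs.
From mathcomp Require Import all_boot.
From mathcomp Require Import perm finmap.
From mathcomp Require Import zify.

(** Call the [b] vertices of the small side columns. In a cover with [k] colours
    per vertex, a packing restricted to the columns is a [k]-row array whose
    columns are permutations of the colour sets, and it extends to a vertex [v]
    of the large side exactly when the rows can be matched with the [k] colours
    of [v] so that no row gets a colour conflicting with an entry of that row.
    By [frobenius_konig] this fails only if, for some nonempty sets of rows and
    of colours of total size greater than [k], every row of the first conflicts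
    with every colour of the second. The vertices of the large side do not
    interact, so there the whole problem is to control such full rectangles.

    Correspondence, upper bound: each of the [b] columns contributes a matching
    of conflicts, so a full rectangle has at most [b] rows and at most [b]
    colours; [k = 2b] suffices whatever the array.

    Lists, upper bound: with [k = b + 1] a bad array may exist (for [b = 2], the
    rows [x y] and [y x] are both blocked for [x] and [y]), so the array has to
    be chosen well. Columns are added one at a time, each ordered so that as
    many colours as possible land in a row that already contains them. For a set
    [T] of colours, if a new column completed [T] in two rows at once, then
    exchanging its two entries there would put both into rows that already have
    them, contradicting maximality. So the number [N] of rows containing [T]
    increases by at most one with each column, which yields [|T| + N <= b + 1]
    as soon as [N > 0] ([columns_alignment]).

    Lower bounds: the large side is so large that every relevant behaviour of
    the columns is anticipated by one of its vertices. For lists of size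
    [j <= b], take [j] columns with disjoint lists; each transversal of these
    lists is the list of some vertex, which blocks the colouring choosing that
    transversal. For correspondence covers with [j < 2b], each family of
    orderings of the columns has a vertex whose conflicts, read in these
    orderings, contain a Latin square of order [m = min(b, j)]. This is a full
    [m] by [m] rectangle, and [2m > j]. *)

Set Implicit Arguments.
Unset Strict Implicit.
Unset Printing Implicit Defensive.

(** * Systems of distinct representatives *)

(** Hall's theorem, by induction on the index set: if a nonempty proper subset
    [S] is tight, represent [S] inside its neighbourhood [U] and the other
    indices outside [U]; if none is tight, any representative of any single
    index can be spent without violating Hall's condition for the rest. *)
Lemma hall (I T : finType) (t0 : T) (N : I -> {set T}) (A : {set I}) :
  (forall S : {set I}, S \subset A -> #|S| <= #|\bigcup_(i in S) N i|) ->
  exists f : I -> T, {in A &, injective f} /\ {in A, forall i, f i \in N i}.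
Proof.
have [n] := ubnP #|A|.
elim: n => // n IH in A N * ; rewrite ltnS => leAn hallA.
have [->|[i0 Ai0]] := set_0Vmem A.
  by exists (fun=> t0); split=> i; rewrite inE.
have [/existsP[S /and4P[sSA S0 ltS tight]]|loose] :=
    boolP [exists S : {set I}, [&& S \subset A, S != set0, #|S| < #|A|
             & #|\bigcup_(i in S) N i| <= #|S|]].
  set U := \bigcup_(i in S) N i in tight.
  have [|S' sS'|f1 [f1_inj f1N]] := IH S N.
  - exact: leq_trans ltS _.
  - exact/hallA/(subset_trans sS').
  have [||f2 [f2_inj f2N]] := IH (A :\: S) (fun i => N i :\: U).
  - rewrite (leq_trans _ leAn) // cardsDS // ltn_subrL.
    by rewrite card_gt0 S0 (leq_trans _ ltS).
  - move=> S' /subsetDP[sS'A dS'S].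
    have := hallA (S :|: S'); rewrite subUset sSA sS'A => /(_ isT).
    rewrite cardsU disjoint_setI0 ?cards0 ?subn0; last by rewrite disjoint_sym.
    have -> : \bigcup_(i in S :|: S') N i = U :|: \bigcup_(i in S') (N i :\: U).
      apply/setP=> x; apply/bigcupP/setUP.
        case=> i /setUP[Si|S'i] Nix; first by left; apply/bigcupP; exists i.
        have [?|nUx] := boolP (x \in U); first by left.
        by right; apply/bigcupP; exists i => //; rewrite inE nUx.
      case=> /bigcupP[i Si]; last case/setDP.
        by exists i; rewrite // inE Si.
      by exists i; rewrite // inE Si orbT.
    move=> le1; rewrite -(leq_add2l #|S|) (leq_trans le1) //.
    by rewrite (leq_trans (leq_card_setU _ _).1) // leq_add2r.
  have f1U i : i \in S -> f1 i \in U.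
    by move=> Si; apply/bigcupP; exists i => //; apply: f1N.
  have f2U i : i \in A -> i \notin S -> f2 i \notin U.
    move=> Ai nSi; have: f2 i \in N i :\: U by apply: f2N; rewrite inE nSi.
    by case/setDP.
  exists (fun i => if i \in S then f1 i else f2 i); split=> [i j Ai Aj|i Ai].
    case: ifPn => Si; case: ifPn => Sj E.
    + exact: f1_inj.
    + by move: (f2U _ Aj Sj); rewrite -E f1U.
    + by move: (f2U _ Ai Si); rewrite E f1U.
    + by apply: f2_inj; rewrite // inE ?Si ?Sj.
  case: ifPn => Si; first exact: f1N.
  have: f2 i \in N i :\: U by apply: f2N; rewrite inE Si.
  by case/setDP.
(* Every nonempty proper subset has a spare neighbour, so removing one point [t]
   is harmless. *)
have := hallA [set i0]; rewrite sub1set Ai0 cards1 big_set1 => /(_ isT).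
rewrite card_gt0 => /set0Pn[t Nt].
have [||f [f_inj fN]] := IH (A :\ i0) (fun i => N i :\ t).
- by rewrite (leq_trans _ leAn) // (cardsD1 i0 A) Ai0.
- move=> S sS; have [->|S0] := eqVneq S set0; first by rewrite cards0.
  have sSA : S \subset A := subset_trans sS (subD1set _ _).
  have ltSA : #|S| < #|A|.
    by apply: proper_card; apply/properP; split=> //; exists i0 => //;
       apply: contraTN Ai0 => /(subsetP sS); rewrite !inE eqxx.
  move: loose; rewrite negb_exists => /forallP/(_ S).
  rewrite sSA S0 ltSA /= -ltnNge => lt1.
  rewrite -ltnS (leq_trans lt1) //.
  rewrite (cardsD1 t) -add1n leq_add ?leq_b1 // subset_leq_card //.
  apply/subsetP=> x /setD1P[xt /bigcupP[i Si Nix]].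
  by apply/bigcupP; exists i => //; rewrite !inE xt.
have fA i : i \in A -> i != i0 -> f i != t /\ f i \in N i.
  move=> Ai ii0; have: f i \in N i :\ t by apply: fN; rewrite !inE ii0.
  by case/setD1P.
exists (fun i => if i == i0 then t else f i); split=> [i j Ai Aj|i Ai].
  have [->|ii0] := eqVneq i i0; have [->|ji0] := eqVneq j i0 => // E.
  + by case: (fA _ Aj ji0) => /eqP[].
  + by case: (fA _ Ai ii0) => /eqP[].
  + by apply: f_inj; rewrite // !inE ?ii0 ?ji0.
by have [->//|ii0] := eqVneq i i0; case: (fA _ Ai ii0).
Qed.

(** Hall's theorem for the colours choosing rows: a set [T] of colours misses
    exactly the rows [S] that are bad for all of [T], so Hall's condition is
    [|T| <= k - |S|], which is automatic when [S] is empty. *)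
Lemma frobenius_konig (k : nat) (bad : rel 'I_k) :
  (forall T : {set 'I_k}, T != set0 ->
     let S := [set i | [forall x in T, bad i x]] in
     S != set0 -> #|T| + #|S| <= k) ->
  exists s : {perm 'I_k}, forall i, ~~ bad i (s i).
Proof.
case: k bad => [|k] bad hbad; first by exists 1%g => -[].
have [|f [f_inj fN]] := @hall _ _ ord0 (fun x => [set i | ~~ bad i x]) setT.
  move=> T _; have [->|T0] := eqVneq T set0; first by rewrite cards0.
  have := hbad T T0; set S := [set i | _] => hS.
  have -> : \bigcup_(x in T) [set i | ~~ bad i x] = ~: S.
    apply/setP=> i; rewrite !inE negb_forall; apply/bigcupP/existsP.
      by case=> x Tx; rewrite inE => nb; exists x; rewrite Tx.
    by case=> x; rewrite negb_imply => /andP[Tx nb]; exists x; rewrite ?inE.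
  have cS := cardsC S; rewrite card_ord in cS.
  have [S0|S0] := eqVneq S set0.
    by move: cS; rewrite S0 cards0 add0n => ->; have := max_card T; rewrite card_ord.
  by rewrite -(leq_add2r #|S|) [_ + #|S|]addnC [X in _ <= X]addnC cS addnC hS.
have f_inj' : injective f by move=> i j; apply: f_inj; rewrite inE.
exists (perm f_inj')^-1%g => i.
have := fN ((perm f_inj')^-1%g i); rewrite !inE => /(_ isT).
by rewrite -(permE f_inj') permKV.
Qed.

(** * Counting *)

Lemma card_exists_le (U X : finType) (P : U -> pred X) :
  (forall u x y, P u x -> P u y -> x = y) ->
  #|[set x | [exists u, P u x]]| <= #|U|.
Proof.
move=> Pfun; case: (pickP (fun u : U => true)) => [u0 _|U0]; last first.
  rewrite [X in X <= _]eq_card0 // => x; rewrite inE.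
  by apply/existsP=> -[u]; have := U0 u.
pose w x := odflt u0 [pick u | P u x].
have wP x : [exists u, P u x] -> P (w x) x.
  by move/existsP=> [u Pu]; rewrite /w; case: pickP => //= /(_ u); rewrite Pu.
rewrite -(@card_in_imset _ _ w) ?max_card // => x y.
by rewrite !inE => /wP Px /wP Py E; apply: Pfun Px _; rewrite E.
Qed.

Lemma surjection_from_ord (T : finType) (t0 : T) (a : nat) :
  #|T| <= a -> exists f : 'I_a -> T, forall t, exists i, f i = t.
Proof.
move=> leTa; exists (fun i => nth t0 (enum T) i) => t.
have lt1 : index t (enum T) < a.
  by rewrite (leq_trans _ leTa) // cardE index_mem mem_enum.
by exists (Ordinal lt1); rewrite /= nth_index // mem_enum.
Qed.

(** * Aligning the columns of an array *)

Section Alignment.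

Variables (k : nat) (C : eqType).

Definition rows_over (F : 'I_k -> seq C) (T : seq C) : {set 'I_k} :=
  [set i | all (mem (F i)) T].

(** The order [t] maximises the number of entries falling into rows that already
    contain them. A row completing [T] through its new entry [x] had every other
    colour of [T] before; two such rows, with new entries [x] and [y], hence
    contain [y] and [x] respectively, and swapping these entries beats [t]. *)
Lemma column_alignment (F : 'I_k -> seq C) (e : 'I_k -> C) :
  injective e ->
  exists t : {perm 'I_k}, forall T : seq C,
    #|rows_over (fun i => e (t i) :: F i) T| <= (#|rows_over F T|).+1.
Proof.
move=> e_inj; pose hits (t : {perm 'I_k}) := [set i | e (t i) \in F i].
case: (@arg_maxnP _ (1%g : {perm 'I_k}) predT (fun t => #|hits t|) isT) => t _ tmax.
exists t => T; set F' := fun i => _ :: _.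
(* In a row that newly contains [T], the new entry is the missing colour. *)
have new_row i : i \in rows_over F' T :\: rows_over F T ->
    [/\ e (t i) \in T, e (t i) \notin F i &
     forall x, x \in T -> x != e (t i) -> x \in F i].
  rewrite !inE => /andP[/allPn[x Tx]].
  rewrite -[X in ~~ X]/(x \in F i) => nFx /allP FT.
  have := FT x Tx; rewrite /= inE (negPf nFx) orbF => /eqP xe; subst x.
  by split=> // y Ty yx; have := FT y Ty; rewrite /= inE (negPf yx).
have le1 : #|rows_over F' T :\: rows_over F T| <= 1.
  apply/card_le1_eqP => i i' /new_row[Tx nFx Fi] /new_row[Ty nFy Fi'].
  apply/eqP/negPn/negP => ii'.
  have yx : e (t i') != e (t i).
    by rewrite (inj_eq e_inj) (inj_eq perm_inj).
  have: #|hits (tperm i i' * t)%g| <= #|hits t| := tmax _ isT.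
  rewrite leqNgt => /negP[].
  apply: proper_card; apply/properP; split.
    apply/subsetP=> j; rewrite !inE permM.
    by case: tpermP => [->|->|//]; rewrite ?(negPf nFx) ?(negPf nFy).
  by exists i; rewrite !inE ?permM ?tpermL // Fi // eq_sym.
rewrite -(cardsID (rows_over F T)) -addn1 leq_add //.
exact: subset_leq_card (subsetIr _ _).
Qed.

(** The bound survives a new column because [N] grows by at most one while
    [size r] grows by one; if [N] was zero before, it is now one, and the row
    containing [T] has room for at most as many colours as there are columns.
    The hypothesis [0 < N] cannot be dropped, as [T] may be large, and the empty
    [T] is contained in all rows. *)
Lemma columns_alignment (U : eqType) (e : U -> 'I_k -> C) (r : seq U) :
  (forall u, injective (e u)) -> uniq r ->
  exists s : U -> {perm 'I_k}, forall T : seq C, uniq T -> T != [::] ->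
    let N := #|rows_over (fun i => [seq e u (s u i) | u <- r]) T| in
    0 < N -> size T + N <= (size r).+1.
Proof.
move=> e_inj; elim: r => [|u r IH] /=.
  move=> _; exists (fun=> 1%g) => -[|x T] //= _ _ /card_gt0P[i].
  by rewrite inE.
case/andP=> nru /IH[s sP].
have [t tP] := column_alignment (fun i => [seq e w (s w i) | w <- r]) (e_inj u).
exists (fun w => if w == u then t else s w) => T uT T0.
have eqF i : [seq e w ((if w == u then t else s w) i) | w <- r]
           = [seq e w (s w i) | w <- r].
  by apply/eq_in_map => w rw; case: eqP => // wu; rewrite -wu rw in nru.
rewrite eqxx.
have -> : rows_over (fun i => e u (t i) ::
      [seq e w ((if w == u then t else s w) i) | w <- r]) T
    = rows_over (fun i => e u (t i) :: [seq e w (s w i) | w <- r]) T.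
  by apply/setP=> i; rewrite !inE eqF.
move=> N0; have := tP T; have := sP T uT T0; rewrite /=.
set N := #|rows_over (fun i => map _ _) T|.
case: (posnP N) => [-> _ N1|_ /(_ isT) le1 le2].
  have /card_gt0P[i] := N0; rewrite inE => /allP sub.
  have := uniq_leq_size uT sub; rewrite /= size_map => leT.
  by rewrite -addn1 leq_add.
by rewrite (leq_trans (leq_add (leqnn _) le2)) // addnS ltnS.
Qed.

End Alignment.

(** * List packings *)

Lemma list_packable_complete_bipartite (a b : nat) :
  list_packable (complete_bipartite a b) b.+1.
Proof.
move=> L cardL.
pose e (v : complete_bipartite a b) (i : 'I_b.+1) := nth 0 (L v) i.
have size_L v : size (L v) = b.+1 by rewrite -(cardL v).
have e_inj v : injective (e v).
  move=> i j /eqP; rewrite nth_uniq ?size_L // ?fset_uniq // => /eqP.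
  exact: val_inj.
have e_in v i : e v i \in L v by apply: mem_nth; rewrite size_L.
have [s sP] := columns_alignment (fun u : 'I_b => e_inj (inr u)) (enum_uniq 'I_b).
set F := (fun i : 'I_b.+1 => [seq e (inr u) (s u i) | u <- enum 'I_b]).
have matched (v : 'I_a) :
    exists t : {perm 'I_b.+1}, forall i, e (inl v) (t i) \notin F i.
  (* A set [T] of colours of [v] is bad for row [i] iff the row contains [T]. *)
  apply: (@frobenius_konig _ (fun i x => e (inl v) x \in F i)) => T T0 S S0.
  have eqS : S = rows_over F [seq e (inl v) x | x <- enum T].
    apply/setP=> i; rewrite !inE all_map; apply/forall_inP/allP => h x.
      by rewrite mem_enum => /h.
    by move=> Tx; apply: (h x); rewrite mem_enum.
  have := sP [seq e (inl v) x | x <- enum T].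
  rewrite map_inj_uniq ?enum_uniq //= -size_eq0 size_map -cardE cards_eq0.
  by rewrite -eqS card_gt0 size_enum_ord; apply.
have [t tP] := fin_all_exists matched.
exists (fun i v => match v with inl v' => e v (t v' i) | inr u => e v (s u i) end).
split=> [i|i j ij [v|u]].
- split=> [[v|u]|[v|u] [v'|u']] //= _ E.
    by have /negP[] := tP v i; rewrite E; apply/mapP; exists u'; rewrite ?mem_enum.
  by have /negP[] := tP v' i; rewrite -E; apply/mapP; exists u; rewrite ?mem_enum.
- by move/e_inj/perm_inj/eqP; rewrite (negPf ij).
- by move/e_inj/perm_inj/eqP; rewrite (negPf ij).
Qed.

(** Any single colouring is already impossible here: its values on the first [j]
    columns form a transversal, which is the list of some vertex. *)
Lemma not_list_packable_complete_bipartite (a b j : nat) :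
  0 < j <= b -> j ^ j <= a -> ~ list_packable (complete_bipartite a b) j.
Proof.
case/andP=> j0 jb lea packable.
pose j1 := Ordinal j0.
have [|f f_surj] := @surjection_from_ord {ffun 'I_j -> 'I_j} [ffun=> j1] a.
  by rewrite card_ffun !card_ord.
(* An injective coding of pairs makes the lists of distinct columns disjoint. *)
pose colour (u y : nat) := choice.pickle (u, y).
have colour_inj u y u' y' : colour u y = colour u' y' -> u = u' /\ y = y'.
  by move/(pcan_inj choice.pickleK) => [].
pose L (v : complete_bipartite a b) : {fset nat} :=
  match v with
  | inl v => [fset colour u (f v u) | u : 'I_j in 'I_j]%fset
  | inr u => [fset colour u (y : 'I_j) | y in 'I_j]%fset
  end.
have [|c [c_col _]] := packable L.
  move=> [v|u] /=; rewrite card_imfset ?size_enum_ord //=.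
  - by move=> u u' /colour_inj[/val_inj].
  - by move=> y y' /colour_inj[_ /val_inj].
have [c_in c_proper] := c_col j1.
have chosen (u : 'I_j) :
    exists y : 'I_j, c j1 (inr (widen_ord jb u)) = colour u y.
  by have /imfsetP[/= y _ ->] := c_in (inr (widen_ord jb u)); exists y.
have [g gP] := fin_all_exists chosen.
have [v fv] := f_surj (finfun g).
have /imfsetP[/= u _ cv] := c_in (inl v).
apply: (c_proper (inl v) (inr (widen_ord jb u))) => //.
by rewrite cv gP fv ffunE.
Qed.

(** * Correspondence packings *)

(** The columns may be ordered arbitrarily: a row conflicts with at most [b]
    colours of [v], one per column, and symmetrically a colour with at most [b]
    rows, so no full rectangle has more than [b + b] lines. *)
Lemma correspondence_packable_complete_bipartite (a b : nat) :
  correspondence_packable (complete_bipartite a b) (2 * b).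
Proof.
move=> H L [[disjL coverL] cardL matchL emptyL].
pose e v (i : 'I_(2 * b)) := enum_val (cast_ord (esym (cardL v)) i).
have e_inj v : injective (e v) by move=> i j /enum_val_inj/cast_ord_inj.
have e_in v i : e v i \in L v := enum_valP _.
have same_part v w x : x \in L v -> x \in L w -> v = w.
  move=> Lv Lw; apply/eqP/negPn/negP => /disjL.
  by move/pred0P/(_ x); rewrite /= Lv Lw.
have mate v w x y z : adj v w -> x \in L v -> y \in L w -> z \in L w ->
    adj x y -> adj x z -> y = z.
  move=> vw Lx Ly Lz xy xz.
  have [] : (x, y) = (x, z); last by [].
  by apply: (matchL v w vw); rewrite ?inE ?Lx ?Ly ?Lz //=; left.
have matched (v : 'I_a) : exists t : {perm 'I_(2 * b)},
    forall i, ~~ [exists u : 'I_b, adj (e (inr u) i) (e (inl v) (t i))].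
  apply: (@frobenius_konig _
    (fun i x => [exists u : 'I_b, adj (e (inr u) i) (e (inl v) x)])).
  move=> T /set0Pn[x0 Tx0] S /set0Pn[i0 Si0].
  have row_bad : #|[set x | [exists u : 'I_b, adj (e (inr u) i0) (e (inl v) x)]]| <= b.
    rewrite -[X in _ <= X]card_ord; apply: card_exists_le => u x y xi yi.
    by apply: (e_inj (inl v)); apply: (mate (inr u) (inl v)) xi yi; rewrite ?e_in.
  have col_bad : #|[set i | [exists u : 'I_b, adj (e (inr u) i) (e (inl v) x0)]]| <= b.
    rewrite -[X in _ <= X]card_ord; apply: card_exists_le => u i i'.
    rewrite adj_sym => xi; rewrite adj_sym => yi.
    by apply: (e_inj (inr u)); apply: (mate (inl v) (inr u)) xi yi; rewrite ?e_in.
  rewrite [X in _ <= X]mul2n -addnn leq_add //.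
    apply: leq_trans row_bad; apply/subset_leq_card/subsetP=> x Tx.
    by move: Si0; rewrite !inE => /forall_inP/(_ x Tx).
  apply: leq_trans col_bad; apply/subset_leq_card/subsetP=> i.
  by rewrite !inE => /forall_inP/(_ x0 Tx0).
have [t tP] := fin_all_exists matched.
pose p i (v : complete_bipartite a b) := match v with inl v' => e v (t v' i) | inr _ => e v i end.
have p_in i v : p i v \in L v by case: v => w /=.
have p_inj i i' v : p i v = p i' v -> i = i'.
  by case: v => w /e_inj => // /perm_inj.
exists (fun i => [set p i v | v : complete_bipartite a b]).
have part i v x : x \in [set p i w | w : complete_bipartite a b] :&: L v -> x = p i v.
  by case/setIP=> /imsetP[w _ ->] /(same_part _ _ _ (p_in i w)) ->.
split=> [i|i i' ii']; last first.
  apply/pred0P=> x; apply/negP=> /andP[/imsetP[v _ ->] /imsetP[w _ E]].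
  have vw : v = w by apply: same_part (p_in i v) _; rewrite E.
  by move/eqP: ii'; apply; apply: (p_inj _ _ v); rewrite E vw.
split=> [v|v w x y vw /part -> /part ->].
  rewrite -(cards1 (p i v)); congr #|pred_of_set _|; apply/setP=> x.
  apply/idP/set1P => [/part //|->].
  by rewrite inE p_in imset_f.
have [|nvw] := boolP (adj v w); last first.
  have /setP/(_ (p i v, p i w)) := emptyL v w vw nvw.
  by rewrite !inE /= !p_in /= => ->.
case: v w {vw} => [v|u] [w|u'] //= _.
  rewrite adj_sym; have := tP v i; rewrite negb_exists => /forallP; exact.
by have := tP w i; rewrite negb_exists => /forallP; exact.
Qed.

(** In the cover below, the vertex indexed by orderings [g v] regards the colour
    [y] of the column [u] as lying in row [g v u y]. Its conflicts are the
    cells of the addition table modulo [m], the cell [(i, x)] being assigned to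
    the column [(i + x) %% m]. The vertex whose orderings are those of a given
    packing is therefore blocked, in each of the first [m] rows, for all of its
    first [m] colours, and only [j - m < m] colours remain for these rows. *)
Lemma not_correspondence_packable_complete_bipartite (a b j : nat) :
  0 < j < 2 * b -> j`! ^ b <= a ->
  ~ correspondence_packable (complete_bipartite a b) j.
Proof.
case/andP=> j0 j2b lea packable.
have [|g g_surj] := @surjection_from_ord {ffun 'I_b -> {perm 'I_j}} [ffun=> 1%g] a.
  by rewrite card_ffun card_Sn card_ord.
pose m := minn b j.
pose conflict (v : 'I_a) (u : 'I_b) (x y : 'I_j) :=
  [&& x < m, g v u y < m & (g v u y + x) %% m == u].
pose e (p q : complete_bipartite a b * 'I_j) := match p.1, q.1 with
  | inl v, inr u => conflict v u p.2 q.2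
  | inr u, inl v => conflict v u q.2 p.2
  | _, _ => false end.
have e_sym : symmetric e by move=> [[v|u] x] [[w|u'] y].
have e_irr : irreflexive e by move=> [[v|u] x].
pose H := SGraph e_sym e_irr.
pose L (v : complete_bipartite a b) : {set H} := [set p | p.1 == v].
have conflict_l v u x y y' : conflict v u x y -> conflict v u x y' -> y = y'.
  case/and3P=> xm ym /eqP E /and3P[_ ym' /eqP E'].
  move/eqP: E; rewrite -E' eqn_modDr !modn_small // => /eqP/val_inj.
  exact: perm_inj.
have conflict_r v u x x' y : conflict v u x y -> conflict v u x' y -> x = x'.
  case/and3P=> xm ym /eqP E /and3P[xm' _ /eqP E'].
  by move/eqP: E; rewrite -E' eqn_modDl !modn_small // => /eqP/val_inj.
have [|I [I_ind I_disj]] := packable H L.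
  split.
  - split=> [v w vw|]; last first.
      by apply/setP=> x; rewrite inE; apply/bigcupP; exists x.1; rewrite ?inE.
    apply/pred0P=> x; apply/negP; rewrite /= !inE => /andP[/eqP xv /eqP xw].
    by rewrite -xv -xw eqxx in vw.
  - move=> v; rewrite -[RHS]card_ord.
    have -> : L v = [set (v, x) | x : 'I_j].
      apply/setP=> -[w x]; rewrite inE; apply/eqP/imsetP => [/= wv|[y _ [//]]].
      by exists x; rewrite ?wv.
    by rewrite card_imset // => x y [].
  - move=> v w vw [[v1 x] [w1 y]] [[v2 x'] [w2 y']]; rewrite !inE /=.
    case/and3P=> /eqP -> /eqP -> E /and3P[/eqP -> /eqP -> E'].
    case: v w vw E E' => [v|u] [w|u'] //= _; rewrite /e /= => E E' [[?]|[?]]; subst.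
    + by rewrite (conflict_l _ _ _ _ _ E E').
    + by rewrite (conflict_r _ _ _ _ _ E E').
    + by rewrite (conflict_r _ _ _ _ _ E E').
    + by rewrite (conflict_l _ _ _ _ _ E E').
  - move=> v w vw nvw; apply/setP=> -[[v1 x] [w1 y]]; rewrite !inE /=.
    apply/negP=> /and3P[/eqP -> /eqP ->].
    by case: v w vw nvw => [v|u] [w|u'].
have chosen (vi : complete_bipartite a b * 'I_j) :
    exists x : 'I_j, (vi.1, x) \in I vi.2.
  case: vi => v i; have [/(_ v)/eqP/cards1P[[w x] E] _] := I_ind i.
  have: (w, x) \in I i :&: L v by rewrite E set11.
  by rewrite !inE /= => /andP[Ix /eqP <-]; exists x.
have [c cP] := fin_all_exists chosen.
have c_inj v : injective (fun i => c (v, i)).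
  move=> i i' E; apply/eqP/negPn/negP => /I_disj/pred0P/(_ (v, c (v, i))) /=.
  by rewrite (cP (v, i)) E (cP (v, i')).
(* The colour [c (inr u, i)] of the column [u] lies in row [i], so the relevant
   ordering is the inverse of [i |-> c (inr u, i)]. *)
pose h (u : 'I_b) : {perm 'I_j} := (perm (c_inj (inr u)))^-1%g.
have [v gv] := g_surj (finfun h).
have m0 : 0 < m by move: j0 j2b; rewrite /m; clear; lia.
have avoid (i : 'I_j) : i < m -> m <= c (inl v, i).
  move=> im; rewrite leqNgt; apply/negP=> xm.
  have ub : (i + c (inl v, i)) %% m < b.
    by rewrite (leq_trans (ltn_pmod _ m0)) // geq_minl.
  have [_ /(_ (inl v) (inr (Ordinal ub)))] := I_ind i.
  move/(_ (inl v, c (inl v, i)) (inr (Ordinal ub), c (inr (Ordinal ub), i))).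
  rewrite !inE /= !eqxx !andbT (cP (inl v, i)) (cP (inr (Ordinal ub), i)).
  move=> /(_ isT isT isT)/negP[]; rewrite /e /= /conflict gv ffunE /h.
  have -> : (perm (c_inj (inr (Ordinal ub))))^-1%g (c (inr (Ordinal ub), i)) = i.
    by rewrite -[in X in _ X = _](permE (c_inj _)) permK.
  by rewrite xm im /= eqxx.
have mj : m <= j := geq_minr _ _.
have card_small : #|[set i : 'I_j | i < m]| = m.
  have widen_inj : injective (widen_ord mj).
    by move=> x y /(congr1 val) /= /val_inj.
  rewrite -[RHS]card_ord -(card_imset _ widen_inj).
  congr #|pred_of_set _|; apply/setP=> i; rewrite inE; apply/idP/imsetP.
    by move=> im; exists (Ordinal im) => //; apply: val_inj.
  by case=> y _ ->; rewrite /= ltn_ord.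
have lt_j2m : j < m + m by move: j0 j2b; rewrite /m; clear; lia.
have: #|[set i : 'I_j | i < m]| <= #|~: [set i : 'I_j | i < m]|.
  rewrite -(card_imset _ (c_inj (inl v))) subset_leq_card //.
  apply/subsetP=> x /imsetP[i]; rewrite !inE => im ->.
  by rewrite -leqNgt avoid.
have := cardsC [set i : 'I_j | i < m]; rewrite card_small card_ord => jE.
by rewrite -(leq_add2l m) jE leqNgt lt_j2m.
Qed.

(** * The packing numbers *)

Theorem corollary34 (b : nat) (hb : 0 < b) :
  exists a0 : nat, forall a : nat, a0 <= a ->
    is_list_packing_number (complete_bipartite a b) b.+1 /\
    is_correspondence_packing_number (complete_bipartite a b) (2 * b).
Proof.
(* [j ^ j <= b ^ b] transversals for [j <= b], and [j`! ^ b] families of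
   orderings for [j < 2 * b]. *)
exists (b ^ b + (2 * b)`! ^ b) => a lea; split; split=> //.
- exact: list_packable_complete_bipartite.
- move=> j j0; rewrite ltnNge; apply: contraPN => jb.
  apply: not_list_packable_complete_bipartite; first by rewrite j0.
  rewrite (leq_trans _ (leq_trans (leq_addr _ _) lea)) //.
  by rewrite (@leq_trans (b ^ j)) ?leq_exp2r ?leq_pexp2l.
- by rewrite muln_gt0.
- exact: correspondence_packable_complete_bipartite.
- move=> j j0; rewrite leqNgt; apply: contraPN => j2b.
  apply: not_correspondence_packable_complete_bipartite; first by rewrite j0.
  rewrite (leq_trans _ (leq_trans (leq_addl _ _) lea)) // leq_exp2r //.
  by rewrite leq_fact // ltnW.
Qed.
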